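(* Let $n\ge1$, let $t_0<t_1<\dots<t_n$ be real numbers, let $y_{t_0},\mu\in\mathbb{R}$ and $\sigma>0$, and let $$Y_{t_i}=y_{t_0}+\mu(t_i-t_0)+\varepsilon_{t_i},\qquad i=1,\dots,n,$$ where $\varepsilon_{t_1},\dots,\varepsilon_{t_n}$ are i.i.d. normal random variables $\mathcal{N}(0,\sigma^2)$ and $y_{t_0}$ is known. Then the maximum likelihood estimator of the slope $\mu$ based on observations $(y_{t_1},\dots,y_{t_n})$ is $$\hat\mu(y_{t_1},\dots,y_{t_n})=\frac{\sum_{i=1}^n(t_i-t_0)(y_{t_i}-y_{t_0})}{\sum_{i=1}^n(t_i-t_0)^2},$$ and $\hat\mu(Y_{t_1},\dots,Y_{t_n})$ is normally distributed with mean $\mu$ and variance $\sigma^2\left(\sum_{i=1}^n(t_i-t_0)^2\right)^{-1}$. In particular, if the time step $\delta:=t_i-t_{i-1}$ is constant for $i=1,\dots,n$, then $$\mathrm{V}(\hat\mu)=\frac{6\sigma^2}{\delta^2\,n(n+1)(2n+1)}.$$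
   Context: The likelihood is the joint density $\mathcal{L}(\mu,\sigma^2\mid y_{t_1},\dots,y_{t_n})=(\sigma\sqrt{2\pi})^{-n}\exp\left(-\frac{1}{2\sigma^2}\sum_{i=1}^n\left(y_{t_i}-y_{t_0}-\mu(t_i-t_0)\right)^2\right)$ and the maximum likelihood estimator of $\mu$ is its maximizer in $\mu\in\mathbb{R}$. $\mathrm{V}$ denotes variance. *)

(* Defs.v *)
From HB Require Import structures.
From mathcomp Require Import all_boot all_order all_algebra.
From mathcomp Require Import all_classical all_reals all_analysis.

Set Implicit Arguments.
Unset Strict Implicit.
Unset Printing Implicit Defensive.

Import Order.TTheory GRing.Theory Num.Theory.
Import numFieldNormedType.Exports.

Local Open Scope classical_set_scope.
Local Open Scope ring_scope.

Definition mutually_independent (R : realType) (d : measure_display)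
    (T : measurableType d) (P : probability T R) (I : finType)
    (X : I -> {RV P >-> R}) : Prop :=
  forall (J : {set I}) (A : I -> set R),
    (forall i, i \in J -> measurable (A i)) ->
    P [set w | forall i, i \in J -> A i (X i w)] =
    (\prod_(i in J) P (X i @^-1` A i))%E.

(* [normal_prob m s] is parametrised by the standard deviation [s], whereas
   [v] is the variance. The condition [0 < v] excludes [normal_prob m 0], which
   by convention is the uniform law on [0, 1]. *)
Definition is_normal (R : realType) (d : measure_display)
    (T : measurableType d) (P : probability T R) (X : T -> R) (m v : R) :
    Prop :=
  [/\ 0 < v, measurable_fun [set: T] X &
      forall A : set R, measurable A ->
        pushforward P X A = normal_prob m (Num.sqrt v) A].

(* The time grid t_0, ..., t_n is [t : 'I_n.+1 -> R]. The observations
   y_{t_1}, ..., y_{t_n} are [y : 'I_n -> R], so that [y i] is the observation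
   at time [t (lift ord0 i)], and the known initial value y_{t_0} is [y0]. *)
Definition likelihood (R : realType) (n : nat) (t : 'I_n.+1 -> R) (y0 : R)
    (mu sigma : R) (y : 'I_n -> R) : R :=
  (sigma * Num.sqrt (2 * pi)) ^- n *
  expR (- (1 / (2 * sigma ^+ 2)) *
    \sum_(i < n) (y i - y0 - mu * (t (lift ord0 i) - t ord0)) ^+ 2).

(* The likelihood is the joint density of independent normal observations. *)
Lemma likelihood_prod_normal_pdf (R : realType) (n : nat) (t : 'I_n.+1 -> R)
    (y0 mu sigma : R) (y : 'I_n -> R) : 0 < sigma ->
  likelihood t y0 mu sigma y =
  \prod_(i < n)
    normal_pdf (y0 + mu * (t (lift ord0 i) - t ord0)) sigma (y i).
Proof.
move=> s0; under eq_bigr do rewrite normal_pdfE ?gt_eqF//.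
rewrite big_split/= prodr_const card_ord -expR_sum /likelihood; congr (_ * _).
  rewrite /normal_peak exprVn -mulrnAr -[pi *+ 2]mulr_natl (sqrtrM _ (sqr_ge0 sigma)).
  by rewrite sqrtr_sqr gtr0_norm.
congr expR; rewrite mulr_sumr; apply: eq_bigr => i _.
rewrite div1r -[sigma ^+ 2 *+ 2]mulr_natl !mulNr mulrC; congr (- (_ ^+ 2 / _)).
by rewrite opprD addrA.
Qed.

Definition is_maximizer (R : realType) (f : R -> R) (x : R) : Prop :=
  forall z, f z <= f x.

(* [L theta y] is the likelihood of the parameter [theta] given the
   observations [y]; "the" estimator is the unique maximizer. *)
Definition is_mle (R : realType) (n : nat) (L : R -> ('I_n -> R) -> R)
    (est : ('I_n -> R) -> R) : Prop :=
  forall y : 'I_n -> R,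
    is_maximizer (L^~ y) (est y) /\
    (forall theta, is_maximizer (L^~ y) theta -> theta = est y).

Definition mu_hat (R : realType) (n : nat) (t : 'I_n.+1 -> R) (y0 : R)
    (y : 'I_n -> R) : R :=
  (\sum_(i < n) (t (lift ord0 i) - t ord0) * (y i - y0)) /
  (\sum_(i < n) (t (lift ord0 i) - t ord0) ^+ 2).

(* Main.v *)
Require Import Defs.
From HB Require Import structures.
From mathcomp Require Import all_boot all_order all_algebra.
From mathcomp Require Import all_classical all_reals all_analysis.
From mathcomp Require Import measurable_realfun.
From mathcomp Require Import ring lra.

Set Implicit Arguments.
Unset Strict Implicit.
Unset Printing Implicit Defensive.

Import Order.TTheory GRing.Theory Num.Theory.
Import numFieldNormedType.Exports.

Local Open Scope classical_set_scope.
Local Open Scope ring_scope.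

(** The exponent of the likelihood is [- (S (m - mu_hat)^2 + r) / (2 sigma^2)],
    where [S] is the sum of the [(t_i - t_0)^2] and [r] does not depend on [m];
    hence [mu_hat] is the unique maximizer. Moreover [mu_hat (Y)] is an affine
    combination of the independent errors. The joint law of two independent
    normal variables is a product measure, whose image under addition has as
    density a convolution of Gaussians; completing the square once more shows
    that this convolution is Gaussian. The mean and the variance are found
    without integration by parts: the ratio of two normal densities has integral
    1 under the second law, and bounding this ratio from below with
    [1 + z <= expR z] gives a family of inequalities between the two moments. As
    equality holds when the two densities coincide, these determine the moments. *)

(** * Affine changes of variables for Lebesgue measure *)

Lemma affine_preimage_itvoc (R : realFieldType) (a b c d : R) : a != 0 ->
  (fun x => a * x + b) @^-1` [set` `]c, d]] =
  if 0 < a then [set` `](c - b) / a, (d - b) / a]]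
  else [set` `[(d - b) / a, (c - b) / a[].
Proof.
move=> a0; case: (ltgtP a 0) a0 => // [a_lt0|a_gt0] _; apply/seteqP;
  split => x; rewrite /= !in_itv/= -!ltrBlDr -!lerBrDr.
- by rewrite ler_ndivrMr// ltr_ndivlMr// ![x * a]mulrC andbC.
- by rewrite ler_ndivrMr// ltr_ndivlMr// ![x * a]mulrC andbC.
- by rewrite ler_pdivlMr// ltr_pdivrMr// ![x * a]mulrC.
- by rewrite ler_pdivlMr// ltr_pdivrMr// ![x * a]mulrC.
Qed.

(** The right-hand side is a measure in [A], so by uniqueness of Lebesgue measure it suffices to
    take [A] half-open. For [a < 0] the preimage is half-open on the other side, which has the same
    length. *)
Lemma lebesgue_measure_affine_preimage (R : realType) (a b : R) (A : set R) :
  a != 0 -> measurable A ->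
  lebesgue_measure A =
  (`|a|%:E * lebesgue_measure ((fun x => (a * x + b)%R) @^-1` A))%E.
Proof.
move=> a0 mA.
have mf : @measurable_fun _ _ (measurableTypeR R) (measurableTypeR R)
    setT (fun x : R => a * x + b).
  exact: measurable_funD.
(* [nu] abstracts over the proofs of [0 <= `|a|] and of measurability. *)
pose nu : {measure set (measurableTypeR R) -> \bar R} :=
  @mscale _ _ _ `|a|%:nng (pushforward (@lebesgue_measure R)
    (fun x : R => a * x + b : measurableTypeR R)).
apply: (@lebesgue_measure_unique R (nu isT mf) _ A mA) => _ [[c d]] _ <-.
rewrite /nu/= /mscale/= /pushforward affine_preimage_itvoc//=.
case: ifPn => [a_gt0|]; last rewrite -leNgt le_eqVlt (negbTE a0)/= => a_lt0.
  rewrite !lebesgue_measure_itv/= !lte_fin ltr_pM2r ?invr_gt0// ltrD2r gtr0_norm//.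
  case: ifP => _; rewrite ?mule0// -EFinM; congr EFin; by field.
rewrite !lebesgue_measure_itv/= !lte_fin ltr_nM2r ?invr_lt0// ltrD2r ltr0_norm//.
by case: ifP => _; rewrite ?mule0// -EFinM; congr EFin; field.
Qed.

Lemma ge0_integral_affine (R : realType) (a b : R) (f : R -> \bar R) :
  a != 0 -> measurable_fun [set: R] f -> (forall x, (0 <= f x)%E) ->
  (\int[lebesgue_measure]_x f x =
   `|a|%:E * \int[lebesgue_measure]_x f (a * x + b)%R)%E.
Proof.
move=> a0 mfR f0.
have mf : @measurable_fun _ _ (measurableTypeR R) (measurableTypeR R)
    setT (fun x : R => a * x + b).
  exact: measurable_funD.
pose nu : {measure set (measurableTypeR R) -> \bar R} :=
  @mscale _ _ _ `|a|%:nng (pushforward (@lebesgue_measure R)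
    (fun x : R => a * x + b : measurableTypeR R)).
rewrite (@eq_measure_integral _ (measurableTypeR R) _ _ (nu isT mf)); last first.
  by move=> A mA _; rewrite [LHS](lebesgue_measure_affine_preimage b a0).
by rewrite ge0_integral_mscale// ge0_integral_pushforward.
Qed.

(** * Integration against a measure given by a density *)

Section density.
Import HBNNSimple.

(** Simple functions increase to [f], and monotone convergence carries the identity from them to
    [f]. *)
Lemma ge0_integral_density d (T : measurableType d) (R : realType)
    (mu nu : {measure set T -> \bar R}) (g : T -> R) (f : T -> \bar R) :
  measurable_fun [set: T] g -> (forall x, 0 <= g x) ->
  (forall A, measurable A -> nu A = \int[mu]_(x in A) (g x)%:E)%E ->
  measurable_fun [set: T] f -> (forall x, (0 <= f x)%E) ->
  (\int[nu]_x f x = \int[mu]_x (f x * (g x)%:E))%E.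
Proof.
move=> mg g0 nuE mf f0; pose h := nnsfun_approx measurableT mf.
have hf x : (h n x)%:E @[n --> \oo] --> f x by exact: cvg_nnsfun_approx.
have ndh x : {homo (fun n => h n x) : m n / (m <= n)%N >-> m <= n}.
  by move=> m n mn; exact/lefP/nd_nnsfun_approx.
transitivity (limn (fun n => \int[nu]_x (h n x)%:E)%E).
  rewrite -monotone_convergence//.
  - by apply: eq_integral => x _; apply/esym/cvg_lim => //; exact: hf.
  - by move=> n; exact/measurable_EFinP/measurable_funP.
  - by move=> n x _; rewrite lee_fin.
  - by move=> x _ m n mn; rewrite lee_fin; exact: ndh.
transitivity (limn (fun n => \int[mu]_x ((h n x)%:E * (g x)%:E))%E); last first.
  rewrite -monotone_convergence//.
  - apply: eq_integral => x _; apply/cvg_lim => //.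
    by apply: cvgeZr => //; exact: hf.
  - by move=> n; apply: emeasurable_funM; exact/measurable_EFinP.
  - by move=> n x _; rewrite -EFinM lee_fin mulr_ge0.
  - by move=> x _ m n mn; rewrite -!EFinM lee_fin ler_wpM2r// ndh.
(* For a simple function both integrals are finite sums over its values, and they agree term by term
   by [nuE] on the level sets. *)
congr (limn _); apply/funext => n.
under eq_integral do rewrite fimfunE -fsumEFin//.
rewrite ge0_integral_fsum//; last 2 first.
- by move=> y; exact/measurable_EFinP/measurable_funM.
- by move=> y x _; rewrite nnfun_muleindic_ge0.
transitivity (\int[mu]_x (\sum_(y \in range (h n))
    (y * \1_(h n @^-1` [set y]) x)%:E * (g x)%:E)%E)%E; last first.
  apply: eq_integral => x _.
  rewrite -ge0_mule_fsuml => [|y]; last exact: nnfun_muleindic_ge0.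
  by rewrite fsumEFin// -fimfunE.
rewrite ge0_integral_fsum//; last 2 first.
- move=> y; apply: emeasurable_funM; apply/measurable_EFinP => //.
  exact: measurable_funM.
- by move=> y x _; apply: mule_ge0; [exact: nnfun_muleindic_ge0|rewrite lee_fin].
apply: eq_fsbigr => r; rewrite inE => -[t _ htr].
have r0 : 0 <= r by rewrite -htr.
under [RHS]eq_integral do rewrite EFinM -muleA.
rewrite integralZl_indic_nnsfun// integral_indic// setIT ge0_integralZl//.
- rewrite nuE//; congr (_ * _)%E; rewrite integral_mkcond.
  by apply: eq_integral => x _; rewrite epatch_indic/= muleC.
- by apply: emeasurable_funM; exact/measurable_EFinP.
- by move=> x _; rewrite mule_ge0 ?lee_fin.
Qed.

End density.

(** * Affine images and convolutions of normal laws *)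

Section normal_distribution.
Context {R : realType}.
Implicit Types (a b m s x y z : R).

Lemma normal_pdf_expR m s x : 0 < s ->
  normal_pdf m s x =
  (s * Num.sqrt (pi *+ 2))^-1 * expR (- (x - m) ^+ 2 / (2 * s ^+ 2)).
Proof.
move=> s0; rewrite normal_pdfE ?gt_eqF// /normal_peak /normal_fun.
by rewrite -mulrnAr sqrtrM ?sqr_ge0// sqrtr_sqr gtr0_norm// mulr_natl.
Qed.

Lemma normal_pdf_affine a b m s x : a != 0 -> 0 < s ->
  normal_pdf (a * m + b) (`|a| * s) (a * x + b) = `|a|^-1 * normal_pdf m s x.
Proof.
move=> a0 s0; rewrite !normal_pdf_expR// ?mulr_gt0 ?normr_gt0//.
rewrite -[_ * s * _]mulrA invfM -mulrA; congr (_ * (_ * expR _)).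
by rewrite exprMn real_normK ?num_real//; field; rewrite a0 gt_eqF.
Qed.

(** For independent normal [U] and [V], both sides are the joint density of [U] and [U + V] at [x]
    and [z]. The right one is the density of the sum times the conditional density of [U] given the
    sum, so integrating out [x] leaves only the first factor. *)
Lemma normal_pdf_convolution m1 s1 m2 s2 x z
    (s := Num.sqrt (s1 ^+ 2 + s2 ^+ 2)) :
  0 < s1 -> 0 < s2 ->
  normal_pdf m1 s1 x * normal_pdf (m2 + x) s2 z =
  normal_pdf (m1 + m2) s z *
  normal_pdf (m1 + s1 ^+ 2 / s ^+ 2 * (z - m1 - m2)) (s1 * s2 / s) x.
Proof.
move=> s1_gt0 s2_gt0.
have s_gt0 : 0 < s by rewrite sqrtr_gt0 addr_gt0// exprn_gt0.
rewrite !normal_pdf_expR ?divr_gt0 ?mulr_gt0//.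
have sE : s ^+ 2 = s1 ^+ 2 + s2 ^+ 2.
  by rewrite sqr_sqrtr// addr_ge0 ?sqr_ge0.
clearbody s.
have : 0 < Num.sqrt (pi *+ 2 : R) by rewrite sqrtr_gt0 mulrn_wgt0// pi_gt0.
move: (Num.sqrt _) => K K_gt0.
rewrite mulrACA [RHS]mulrACA -!expRD; congr (_ * expR _).
  by field; rewrite !gt_eqF.
have S_gt0 : 0 < s1 ^+ 2 + s2 ^+ 2 by rewrite -sE exprn_gt0.
rewrite !exprMn exprVn sE.
by field; rewrite !gt_eqF.
Qed.

(** This moves a variable mean into the argument, where measurability in both variables follows by
    composition. *)
Lemma normal_pdf_shift m s x y : 0 < s ->
  normal_pdf (m + y) s x = normal_pdf m s (x - y).
Proof.
move=> s0; have := normal_pdf_affine y m (x - y) (oner_neq0 R) s0.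
by rewrite !mul1r subrK normr1 invr1 !mul1r.
Qed.

Lemma ge0_integral_normal_prob m s (f : R -> \bar R) :
  measurable_fun [set: R] f -> (forall x, (0 <= f x)%E) ->
  (\int[normal_prob m s]_x f x =
   \int[lebesgue_measure]_x (f x * (normal_pdf m s x)%:E))%E.
Proof.
move=> mf f0; apply: ge0_integral_density => //.
- exact: measurable_normal_pdf.
- exact: normal_pdf_ge0.
Qed.

(** The factor [|a|] from the change of variables cancels the [|a|^-1] by which the density is
    scaled. *)
Lemma normal_prob_affine_preimage a b m s (A : set R) :
  a != 0 -> 0 < s -> measurable A ->
  normal_prob m s ((fun x => a * x + b) @^-1` A) =
  normal_prob (a * m + b) (`|a| * s) A.
Proof.
move=> a0 s0 mA; rewrite /normal_prob [RHS]integral_mkcond.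
rewrite [RHS](@ge0_integral_affine _ a b)//; last 2 first.
- apply/(measurable_restrictT _ _).1 => //; apply/measurable_funTS/measurable_EFinP.
  exact: measurable_normal_pdf.
- by apply: erestrict_ge0 => x _; rewrite lee_fin normal_pdf_ge0.
rewrite -ge0_integralZl//; last 2 first.
- apply: measurableT_comp; last exact: measurable_funD.
  apply/(measurable_restrictT _ _).1 => //; apply/measurable_funTS/measurable_EFinP.
  exact: measurable_normal_pdf.
- move=> x _; apply: erestrict_ge0 => y _.
  by rewrite lee_fin normal_pdf_ge0.
rewrite [LHS]integral_mkcond; apply: eq_integral => x _.
rewrite !patchE; have -> : (x \in (fun x => a * x + b) @^-1` A) = (a * x + b \in A).
  by apply/idP/idP => /set_mem/mem_set.
case: ifPn => _; last by rewrite mule0.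
by rewrite normal_pdf_affine// -EFinM mulVKf// normr_eq0.
Qed.

Lemma normal_prob_add m1 s1 m2 s2 (A : set R) : 0 < s1 -> 0 < s2 ->
  measurable A ->
  (normal_prob m1 s1 \x normal_prob m2 s2)%E ((fun p => p.1 + p.2) @^-1` A) =
  normal_prob (m1 + m2) (Num.sqrt (s1 ^+ 2 + s2 ^+ 2)) A.
Proof.
move=> s1_gt0 s2_gt0 mA; rewrite /product_measure1.
set s := Num.sqrt _; set sum := (fun p : R * R => p.1 + p.2).
have s_gt0 : 0 < s by rewrite sqrtr_gt0 addr_gt0// exprn_gt0.
have mB : measurable (sum @^-1` A).
  by rewrite -[_ @^-1` _]setTI; apply: measurable_funD.
rewrite ge0_integral_normal_prob//; last exact: measurable_fun_xsection.
(* The joint density of the first variable and the sum, cut off to sums in [A]. *)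
pose f (p : R * R) :=
  ((\1_A p.2)%:E * (normal_pdf m1 s1 p.1 * normal_pdf (m2 + p.1) s2 p.2)%:E)%E.
have mf : measurable_fun setT f.
  apply: emeasurable_funM; apply/measurable_EFinP.
    by apply: (measurableT_comp (measurable_indic mA)); exact: measurable_snd.
  apply: measurable_funM.
    by apply: measurableT_comp => //; exact: measurable_normal_pdf.
  under eq_fun do rewrite normal_pdf_shift//.
  apply: measurableT_comp; first exact: measurable_normal_pdf.
  exact: measurable_funB.
have f0 p : (0 <= f p)%E.
  by rewrite mule_ge0 ?lee_fin// mulr_ge0// normal_pdf_ge0.
transitivity (\int[lebesgue_measure]_x \int[lebesgue_measure]_z f (x, z))%E.
  apply: eq_integral => x _ /=.
  (* Once the first variable equals [x], the sum is the second variable translated by [x], hence has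
     mean [m2 + x]. *)
  have -> : xsection (sum @^-1` A) x = (fun y => 1 * y + x) @^-1` A.
    by apply/seteqP; split => y; rewrite /xsection/= inE /sum/= mul1r addrC.
  rewrite normal_prob_affine_preimage// mul1r normr1 mul1r /normal_prob.
  rewrite -ge0_integralZr//; last 3 first.
  - apply/measurable_funTS/measurable_EFinP; exact: measurable_normal_pdf.
  - by move=> z _; rewrite lee_fin normal_pdf_ge0.
  - by rewrite lee_fin normal_pdf_ge0.
  rewrite integral_mkcond; apply: eq_integral => z _.
  by rewrite epatch_indic /f/= muleC -EFinM [in RHS]mulrC.
(* The order is exchanged so that the conditional density is integrated first, giving 1. *)
transitivity (\int[lebesgue_measure]_z \int[lebesgue_measure]_x f (x, z))%E.
  exact: (@fubini_tonelli _ _ _ _ _ lebesgue_measure lebesgue_measure f).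
rewrite /normal_prob [RHS]integral_mkcond.
apply: eq_integral => z _; rewrite epatch_indic/= /f/=.
under eq_integral do rewrite normal_pdf_convolution// EFinM muleA.
rewrite ge0_integralZl//.
- by rewrite integral_normal_pdf mule1 muleC.
- by apply/measurable_EFinP; exact: measurable_normal_pdf.
- by move=> x _; rewrite lee_fin normal_pdf_ge0.
- by rewrite mule_ge0 ?lee_fin// normal_pdf_ge0.
Qed.

End normal_distribution.

(** * Mean and variance of a normal law *)

(* Both sides vanish at [r = 1], so their derivatives [2 * k] and [2] agree. *)
Lemma tangent_bound_unique (R : realFieldType) (k : R) : 0 <= k ->
  (forall r, 0 < r -> k * (r ^+ 2 - 1) <= 2 * r ^+ 2 * (r - 1)) -> k = 1.
Proof.
(* At [r = 1 + h] the right side minus the left is [- h ^+ 2 * (5 + 2 * h)], which forces [h = 0].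
   The divisor 4 keeps [r] positive, as [0 <= k] gives [- 1 / 4 <= h]. *)
move=> k0 kP; pose h := (k - 1) / 4.
have kE : k = 1 + 4 * h by rewrite /h; field.
have h_ge : - 1 / 4 <= h by rewrite /h; lra.
have h0 : h ^+ 2 * (5 + 2 * h) <= 0.
  have r0 : 0 < 1 + h by lra.
  have := kP _ r0; rewrite {1}kE -subr_ge0 => kr.
  rewrite -oppr_ge0; apply: le_trans kr _; rewrite le_eqVlt; apply/orP; left.
  by apply/eqP; ring.
have : h ^+ 2 <= 0 by rewrite -(@pmulr_lle0 _ (5 + 2 * h)) 1?mulrC//; lra.
by rewrite kE real_exprn_even_le0// ?num_real// => /eqP ->; rewrite mulr0 addr0.
Qed.

(* The logarithm of the ratio of the densities of N(m', s'^2) and N(m, v), up to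
   the additive constant [ln (Num.sqrt v / s')]. *)
Definition normal_log_ratio (R : realType) (m v m' s' x : R) : R :=
  (x - m) ^+ 2 / (2 * v) - (x - m') ^+ 2 / (2 * s' ^+ 2).

Section normal_moments.
Context {R : realType} {d : measure_display} {T : measurableType d}.
Variables (P : probability T R) (X : T -> R) (m v : R).
Hypothesis Xnormal : is_normal P X m v.

Let v_gt0 : 0 < v. Proof. by case: Xnormal. Qed.

Let mX : measurable_fun [set: T] X. Proof. by case: Xnormal. Qed.

Local Notation s := (Num.sqrt v).

Let s_gt0 : 0 < s. Proof. by rewrite sqrtr_gt0. Qed.

Let sE : s ^+ 2 = v. Proof. by rewrite sqr_sqrtr// ltW. Qed.

Lemma ge0_integral_comp_normal (f : R -> \bar R) :
  measurable_fun [set: R] f -> (forall x, (0 <= f x)%E) ->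
  (\int[P]_w f (X w) =
   \int[lebesgue_measure]_x (f x * (normal_pdf m (Num.sqrt v) x)%:E))%E.
Proof.
move=> mf f0; rewrite -ge0_integral_normal_prob//.
have mXR : @measurable_fun _ _ T (measurableTypeR R) setT X by exact: mX.
pose law : {measure set (measurableTypeR R) -> \bar R} :=
  pushforward P (X : T -> measurableTypeR R).
rewrite -(@eq_measure_integral _ (measurableTypeR R) _ _ _ (law mXR)).
  by rewrite (ge0_integral_pushforward mXR).
by move=> A mA _; case: Xnormal => _ _; exact.
Qed.

Local Notation Z := (normal_log_ratio m v).

Let mZ m' s' : measurable_fun [set: T] (Z m' s' \o X).
Proof.
apply: measurable_funB; apply: measurable_funM => //; apply: measurable_funX;
  exact: measurable_funB.
Qed.

(** Multiplying the density of [X] by this exponential gives [s' / s] times the density with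
    parameters [m'] and [s'], whose integral is 1. *)
Lemma integral_expR_likelihood_ratio m' s' : 0 < s' ->
  (\int[P]_w (expR (Z m' s' (X w)))%:E = (s' / s)%:E)%E.
Proof.
move=> s'0; rewrite (ge0_integral_comp_normal (f := EFin \o (expR \o Z m' s'))).
- rewrite -[RHS]mule1 -(integral_normal_pdf m' s') -ge0_integralZl//.
  + apply: eq_integral => x _ /=; rewrite -!EFinM; congr EFin.
    rewrite !normal_pdf_expR//.
    have : 0 < Num.sqrt (pi *+ 2 : R) by rewrite sqrtr_gt0 mulrn_wgt0// pi_gt0.
    move: (Num.sqrt (pi *+ 2)) => K K_gt0.
    rewrite mulrCA -expRD [RHS]mulrA; congr (_ * expR _).
      by field; rewrite !gt_eqF.
    by rewrite sE /normal_log_ratio; field; rewrite !gt_eqF.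
  + by apply/measurable_EFinP; exact: measurable_normal_pdf.
  + by move=> x _; rewrite lee_fin normal_pdf_ge0.
  + by rewrite lee_fin divr_ge0// ltW.
- apply/measurable_EFinP/measurableT_comp => //.
  by apply: measurable_funB; apply: measurable_funM => //; apply: measurable_funX;
    exact: measurable_funB.
- by move=> x; rewrite lee_fin expR_ge0.
Qed.

Let iexp m' s' : 0 < s' ->
  P.-integrable [set: T] (fun w => (expR (Z m' s' (X w)))%:E).
Proof.
move=> s'0; apply/integrableP; split.
  by apply/measurable_EFinP/measurableT_comp => //; exact: mZ.
under eq_integral do rewrite /= ger0_norm ?expR_ge0//.
by rewrite integral_expR_likelihood_ratio// ltry.
Qed.

(** For [m' = m] and [s' = 2 * s] the log-ratio is the square divided by [8 / 3 * v], and its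
    exponential, which exceeds it, is integrable. *)
Lemma integrable_sqr_centered_normal :
  P.-integrable [set: T] (fun w => ((X w - m) ^+ 2)%:E).
Proof.
have s2 : 0 < 2 * s by rewrite mulr_gt0.
apply: (le_integrable _ _ _
  (integrableZl measurableT (8 / 3 * v) (iexp m s2))) => //.
- by apply/measurable_EFinP/measurable_funX; exact: measurable_funB.
- move=> w _; rewrite -EFinM !abse_EFin lee_fin.
  have v0 := v_gt0; rewrite ger0_norm ?sqr_ge0// ger0_norm; last first.
    by rewrite mulr_ge0 ?expR_ge0//; lra.
  rewrite -ler_pdivrMl; last lra.
  apply: le_trans (expR_ge1Dx _); rewrite /normal_log_ratio exprMn sE.
  rewrite (_ : (8 / 3 * v)^-1 * _ =
    (X w - m) ^+ 2 / (2 * v) - (X w - m) ^+ 2 / (2 * (2 ^+ 2 * v))).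
    by rewrite lerDr.
  by field; rewrite gt_eqF.
Qed.

(** Domination by [1 + u ^+ 2], where [u] is the centered variable. *)
Lemma integrable_centered_normal :
  P.-integrable [set: T] (fun w => (X w - m)%:E).
Proof.
have i1 : P.-integrable [set: T] (cst 1%E).
  exact: finite_measure_integrable_cst.
apply: (le_integrable _ _ _
  (integrableD measurableT i1 integrable_sqr_centered_normal)) => //.
- by apply/measurable_EFinP; exact: measurable_funB.
- move=> w _; rewrite -[cst 1%E w]/(1%:E) -EFinD !abse_EFin lee_fin.
  rewrite [leRHS]ger0_norm ?addr_ge0 ?sqr_ge0// ler_norml.
  move: (X w - m) => u; have := sqr_ge0 (u + 1); have := sqr_ge0 (u - 1).
  by have := sqr_ge0 u; rewrite sqrrD1 sqrrB1 => *; apply/andP; split; lra.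
Qed.

Let e1 := fine (\int[P]_w (X w - m)%:E)%E.
Let e2 := fine (\int[P]_w ((X w - m) ^+ 2)%:E)%E.

Let e1E : (\int[P]_w (X w - m)%:E = e1%:E)%E.
Proof.
by rewrite fineK// integrable_fin_num// integrable_centered_normal.
Qed.

Let e2E : (\int[P]_w ((X w - m) ^+ 2)%:E = e2%:E)%E.
Proof.
by rewrite fineK// integrable_fin_num// integrable_sqr_centered_normal.
Qed.

(** This integrates [1 + z <= expR z] with [z] the log-ratio for [m' = m + t], a quadratic
    polynomial in the centered variable. *)
Let moment_bound t s' : 0 < s' ->
  (1 - t ^+ 2 / (2 * s' ^+ 2)) + (1 / (2 * v) - 1 / (2 * s' ^+ 2)) * e2 +
  t / s' ^+ 2 * e1 <= s' / s.
Proof.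
move=> s'0.
set a := 1 - _; set b := 1 / _ - _; set c := t / _.
have i1 : P.-integrable [set: T] (cst a%:E).
  exact: finite_measure_integrable_cst.
have i2 := integrableZl measurableT b integrable_sqr_centered_normal.
have i3 := integrableZl measurableT c integrable_centered_normal.
have i12 := integrableD measurableT i1 i2.
rewrite -lee_fin -(integral_expR_likelihood_ratio (m + t))//.
rewrite (EFinD (a + _)) (EFinD a) (EFinM b) (EFinM c) -e2E -e1E.
rewrite -integralZl//; last exact: integrable_sqr_centered_normal.
rewrite -integralZl//; last exact: integrable_centered_normal.
have -> : a%:E = (\int[P]_w a%:E)%E.
  by rewrite integral_cst//= probability_setT mule1.
rewrite -integralD// -integralD//.
apply: le_integral => //; [exact: integrableD|exact: iexp|].
move=> w _; rewrite -!EFinM -!EFinD lee_fin; apply: le_trans (expR_ge1Dx _).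
rewrite le_eqVlt; apply/orP; left; apply/eqP; rewrite /a /b /c /normal_log_ratio.
by field; rewrite !gt_eqF.
Qed.

Lemma expectation_normal : ('E_P[X] = m%:E)%E.
Proof.
have e10 : e1 = 0.
  (* With [s' = s] the bound says [t * e1 <= t ^+ 2 / 2]; taking [t = e1] forces [e1 = 0]. *)
  have := moment_bound e1 s_gt0; rewrite sE divff ?gt_eqF// -subr_ge0.
  rewrite (_ : 1 - _ = - (e1 ^+ 2 / (2 * v))); last by field; rewrite gt_eqF.
  rewrite oppr_ge0 pmulr_lle0 ?invr_gt0 ?mulr_gt0// real_exprn_even_le0 ?num_real//.
  by move/eqP.
rewrite unlock; transitivity (\int[P]_w ((X w - m)%:E + m%:E))%E.
  by apply: eq_integral => w _; rewrite -EFinD subrK.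
rewrite integralD//; last 2 first.
- exact: integrable_centered_normal.
- exact: finite_measure_integrable_cst.
by rewrite e1E e10 add0e integral_cst//= probability_setT mule1.
Qed.

Lemma variance_normal : 'V_P[X] = v%:E.
Proof.
rewrite /variance unlock expectation_normal/= unlock /=.
transitivity (\int[P]_w ((X w - m) ^+ 2)%:E)%E.
  by apply: eq_integral => w _; rewrite !fctE/= -expr2.
rewrite e2E; congr EFin; apply/divr1_eq; apply: tangent_bound_unique.
  rewrite divr_ge0 ?(ltW v_gt0)// -lee_fin -e2E integral_ge0// => w _.
  by rewrite lee_fin sqr_ge0.
(* Taking [t = 0] and [s' = r * s], then multiplying by [2 * r ^+ 2], gives the hypothesis of
   [tangent_bound_unique] for [k = e2 / v]. *)
move=> r r0; have := moment_bound 0 (mulr_gt0 r0 s_gt0).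
rewrite expr0n/= !mul0r subr0 addr0 exprMn sE mulfK ?gt_eqF// => rB.
have r2 : 0 < 2 * r ^+ 2 by rewrite mulr_gt0// exprn_gt0.
have := ler_wpM2l (ltW r2) rB; rewrite -subr_ge0 => rB'; rewrite -subr_ge0.
apply: le_trans rB' _; rewrite le_eqVlt; apply/orP; left; apply/eqP.
by field; rewrite !gt_eqF.
Qed.

End normal_moments.

(** * Sums of independent normal variables *)

Section independence.
Context {R : realType} {d : measure_display} {T : measurableType d}.
Variable P : probability T R.

Lemma mutually_independent_comp (I : finType) (X : I -> {RV P >-> R})
    (f : I -> {mfun R >-> R}) :
  mutually_independent X ->
  mutually_independent (fun i => (f i \o X i : {mfun T >-> R}) : {RV P >-> R}).
Proof.
move=> indepX J A mA; have := indepX J (fun i => f i @^-1` A i); apply => i iJ.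
by rewrite -[X in measurable X]setTI; apply: measurable_funP => //; exact: mA.
Qed.

Lemma is_normal_affine (X : T -> R) (m v a b : R) : a != 0 ->
  is_normal P X m v ->
  is_normal P (fun w => a * X w + b) (a * m + b) (a ^+ 2 * v).
Proof.
move=> a0 [v0 mX Xnormal]; have a2 : 0 < a ^+ 2 by rewrite exprn_even_gt0.
split => [||A mA]; first by rewrite mulr_gt0.
  by apply: measurable_funD => //; exact: measurable_funM.
rewrite sqrtrM ?sqr_ge0// sqrtr_sqr -normal_prob_affine_preimage ?sqrtr_gt0//.
have mf : measurable_fun [set: R] (fun x => a * x + b).
  by apply: measurable_funD => //; exact: measurable_funM.
by rewrite -Xnormal// -[X in measurable X]setTI; exact: mf.
Qed.

(** Used in the induction on sums to turn a summand into one more carried event. *)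
Lemma forall_setU1_preimage (I : finType) (U V : Type) (X : I -> U -> V) (i : I)
    (J : {set I}) (A : set V) (B : I -> set V) : i \notin J ->
  [set w | forall j, j \in i |: J -> (if j == i then A else B j) (X j w)] =
  X i @^-1` A `&` [set w | forall j, j \in J -> B j (X j w)].
Proof.
move=> iJ; apply/seteqP; split => w /= => [H|[Aw Bw] j].
  split; first by have := H i (setU11 _ _); rewrite eqxx.
  move=> j jJ; have := H j; rewrite inE jJ orbT ifN; first exact.
  by apply: contraNneq iJ => <-.
by rewrite !inE; case: eqVneq => [->|_] //=; exact: Bw.
Qed.

Lemma prode_setU1_preimage (I : finType) (X : I -> T -> R) (i : I)
    (J : {set I}) (A : set R) (B : I -> set R) : i \notin J ->
  (\prod_(j in i |: J) P (X j @^-1` (if j == i then A else B j)) =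
   P (X i @^-1` A) * \prod_(j in J) P (X j @^-1` B j))%E.
Proof.
move=> iJ; rewrite big_setU1//= eqxx; congr (_ * _)%E.
apply: eq_bigr => j jJ; rewrite ifN//.
by apply: contraNneq iJ => <-.
Qed.

(* Since independence is only known through joint events, the remaining
   variables are carried along in the induction as arbitrary events [B j]. *)
Lemma sum_normal_joint (I : finType) (X : I -> {RV P >-> R}) (m v : I -> R) :
  mutually_independent X -> (forall i, is_normal P (X i) (m i) (v i)) ->
  forall (i : I) (s : seq I) (J : {set I}) (A : set R) (B : I -> set R),
    uniq (i :: s) -> {in i :: s, forall j, j \notin J} ->
    measurable A -> (forall j, j \in J -> measurable (B j)) ->
  P ([set w | A (\sum_(k <- i :: s) X k w)] `&`
     [set w | forall j, j \in J -> B j (X j w)]) =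
  (normal_prob (\sum_(k <- i :: s) m k) (Num.sqrt (\sum_(k <- i :: s) v k)) A *
   \prod_(j in J) P (X j @^-1` B j))%E.
Proof.
move=> indepX normalX i s.
have lawX j A : measurable A ->
    P (X j @^-1` A) = normal_prob (m j) (Num.sqrt (v j)) A.
  by case: (normalX j) => _ _; exact.
have v_gt0 j : 0 < v j by case: (normalX j).
elim: s i => [|i' s IH] i J A B uis isJ mA mB.
  rewrite !big_seq1 -lawX//.
  have iJ : i \notin J by apply: isJ; rewrite mem_seq1.
  rewrite -prode_setU1_preimage//.
  rewrite -(indepX (i |: J) (fun j => if j == i then A else B j)); last first.
    by move=> j; rewrite !inE; case: eqVneq => //= _; exact: mB.
  rewrite forall_setU1_preimage//; congr (P (_ `&` _)).
  by apply/seteqP; split => w; rewrite /= big_seq1.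
set E := [set w | forall j, j \in J -> B j (X j w)].
have mE : measurable E.
  rewrite (_ : E = \bigcap_(j in [set` J]) (X j @^-1` B j)).
    apply: fin_bigcap_measurable; first exact: finite_finset.
    move=> j jJ; rewrite -[X in measurable X]setTI.
    by apply: measurable_funP => //; exact: mB.
  by apply/seteqP; split => w /= h j; exact: h.
(* The probability of the carried events becomes a finite scalar, so that it can rescale a
   measure. *)
have [k kE] : exists k : {nonneg R},
    (\prod_(j in J) P (X j @^-1` B j) = k%:num%:E)%E.
  have c_fin : (\prod_(j in J) P (X j @^-1` B j))%E \is a fin_num.
    apply: prode_fin_num => j jJ; apply: fin_num_measure.
    rewrite -[X in measurable X]setTI.
    by apply: measurable_funP => //; exact: mB.
  have c_ge0 : 0 <= fine (\prod_(j in J) P (X j @^-1` B j))%E.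
    by apply/fine_ge0/prode_ge0.
  by exists (NngNum c_ge0); rewrite /= fineK.
pose S w := \sum_(k <- i' :: s) X k w.
have mS : measurable_fun setT S by exact: measurable_sum.
pose g w : measurableTypeR R * measurableTypeR R := (X i w, S w).
have mg : measurable_fun setT g.
  apply: (@measurable_fun_pair _ _ _ T (measurableTypeR R) (measurableTypeR R)).
    by have [_ mXi _] := normalX i; exact: mXi.
  exact: mS.
(* The joint law of [X i] and the remaining sum, restricted to the carried events [E]. *)
pose Q : {measure set (measurableTypeR R * measurableTypeR R) -> \bar R} :=
  pushforward (mrestr P mE) g.
pose add (p : measurableTypeR R * measurableTypeR R) : measurableTypeR R :=
  p.1 + p.2.
have mAdd : measurable (add @^-1` A).
  by rewrite -[X in measurable X]setTI; apply: measurable_funD.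
pose Ni := normal_prob (m i) (Num.sqrt (v i)).
pose Ns := normal_prob (\sum_(k <- i' :: s) m k)
  (Num.sqrt (\sum_(k <- i' :: s) v k)).
transitivity (Q mg (add @^-1` A)).
  by congr (P (_ `&` _)); apply/seteqP; split => w; rewrite /= big_cons.
(* A product measure is determined by its values on rectangles, so [Q] need only be computed on [A1]
   times [A2]. *)
transitivity ((mscale k Ni \x Ns)%E (add @^-1` A)).
  symmetry; apply: (@product_measure_unique _ _ _ _ R (mscale k Ni) Ns (Q mg))
    => // A1 A2 mA1 mA2.
  have iJ : i \notin J by apply: isJ; rewrite mem_head.
  transitivity (Ns A2 * (Ni A1 * k%:num%:E))%E; last first.
    by rewrite /= /mscale/= muleC (muleC (Ni A1)).
  (* The induction hypothesis handles the shorter sum, with [X i] in [A1] joining the carried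
     events. *)
  have <- : P ([set w | A2 (\sum_(k <- i' :: s) X k w)] `&`
      [set w | forall j, j \in i |: J -> (if j == i then A1 else B j) (X j w)]) =
      (Ns A2 * (Ni A1 * k%:num%:E))%E.
    rewrite /Ni -lawX// -kE -prode_setU1_preimage//.
    apply: (IH i' (i |: J) A2 (fun j => if j == i then A1 else B j)) => //.
    - by case/andP: uis.
    - move=> j js; rewrite in_setU1 negb_or isJ; last by rewrite inE js orbT.
      by rewrite andbT; apply: contraTneq js => ->; case/andP: uis.
    - by move=> j; rewrite !inE; case: eqVneq => //= _; exact: mB.
  rewrite forall_setU1_preimage// setICA setIA.
  by congr (P (_ `&` _)); apply/seteqP; split.
rewrite /product_measure1 ge0_integral_mscale//; last first.
  exact: measurable_fun_xsection.
have Sv_gt0 : 0 < \sum_(k <- i' :: s) v k.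
  by rewrite big_cons ltr_wpDr// sumr_ge0// => j _; exact: ltW.
rewrite -[X in (_ * X)%E]/((Ni \x Ns)%E (add @^-1` A)).
rewrite normal_prob_add ?sqrtr_gt0//.
rewrite !sqr_sqrtr ?ltW// kE muleC.
by rewrite [\sum_(j <- [:: i, i' & s]) m j]big_cons
  [\sum_(j <- [:: i, i' & s]) v j]big_cons.
Qed.

Lemma is_normal_sum n (X : 'I_n -> {RV P >-> R}) (m v : 'I_n -> R) :
  (0 < n)%N -> mutually_independent X ->
  (forall i, is_normal P (X i) (m i) (v i)) ->
  is_normal P (fun w => \sum_i X i w) (\sum_i m i) (\sum_i v i).
Proof.
case: n X m v => // n X m v _ indepX normalX; split=> [||A mA].
- have v_gt0 i : 0 < v i by case: (normalX i).
  by rewrite big_ord_recl ltr_wpDr// sumr_ge0// => j _; exact: ltW.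
- by apply: measurable_sum.
(* With [J] empty there are no carried events, and the joint statement becomes the law of the full
   sum. *)
- have := @sum_normal_joint _ X m v indepX normalX ord0
    (map (lift ord0) (index_enum 'I_n)) finset.set0 A (fun=> setT).
  have -> : ord0 :: map (lift ord0) (index_enum 'I_n) = index_enum 'I_n.+1.
    by rewrite /index_enum -!enumT enum_ordSl.
  rewrite big_set0 mule1 => <-//.
  + rewrite /pushforward; congr (P _).
    by apply/seteqP; split => w //= [].
  + by rewrite index_enum_uniq.
  + by move=> j _; rewrite inE.
Qed.

End independence.

(** * Maximization of the likelihood *)

Section least_squares.
Context {R : realType} {n : nat}.
Variables (t : 'I_n.+1 -> R) (y0 : R).

Local Notation h i := (t (lift ord0 i) - t ord0).
Local Notation S := (\sum_(i < n) h i ^+ 2).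

Lemma sum_sqr_residuals (y : 'I_n -> R) (m : R) : S != 0 ->
  \sum_(i < n) (y i - y0 - m * h i) ^+ 2 =
  S * (m - mu_hat t y0 y) ^+ 2 +
  (\sum_(i < n) (y i - y0) ^+ 2 - (\sum_(i < n) h i * (y i - y0)) ^+ 2 / S).
Proof.
move=> S0; rewrite /mu_hat.
under eq_bigr => i _.
  rewrite (_ : _ ^+ 2 = (y i - y0) ^+ 2 +
    (- 2 * m * (h i * (y i - y0)) + m ^+ 2 * h i ^+ 2)); last by ring.
  over.
rewrite !big_split/= -!mulr_sumr; move: S S0 => s s0.
by field.
Qed.

(** The remainder of the completed square cancels and the negative factor in the exponent reverses
    the order, so likelihoods compare as distances to [mu_hat]. *)
Lemma likelihood_le (sigma m m' : R) (y : 'I_n -> R) : 0 < S -> 0 < sigma ->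
  (likelihood t y0 m sigma y <= likelihood t y0 m' sigma y) =
  ((m' - mu_hat t y0 y) ^+ 2 <= (m - mu_hat t y0 y) ^+ 2).
Proof.
move=> S0 sigma0; rewrite /likelihood !sum_sqr_residuals ?gt_eqF//.
have c0 : 0 < sigma * Num.sqrt (2 * pi).
  by rewrite mulr_gt0// sqrtr_gt0 mulr_gt0// pi_gt0.
rewrite ler_pM2l ?invr_gt0 ?exprn_gt0// ler_expR !mulNr lerN2.
by rewrite ler_pM2l ?divr_gt0 ?mulr_gt0 ?exprn_gt0// lerD2r ler_pM2l.
Qed.

Lemma is_mle_mu_hat (sigma : R) : 0 < S -> 0 < sigma ->
  is_mle (fun m y => likelihood t y0 m sigma y) (mu_hat t y0).
Proof.
move=> S0 sigma0 y; split => [z|theta].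
  by rewrite likelihood_le// subrr expr0n sqr_ge0.
move=> /(_ (mu_hat t y0 y)); rewrite likelihood_le// subrr expr0n/=.
by rewrite real_exprn_even_le0 ?num_real// subr_eq0 => /eqP.
Qed.

End least_squares.

(** * Equally spaced grids and the theorem *)

Lemma sum_sqr_nat (R : fieldType) n : (6 : R) != 0 ->
  \sum_(i < n) (i.+1%:R : R) ^+ 2 = n%:R * (n%:R + 1) * (2 * n%:R + 1) / 6.
Proof.
move=> n6; elim: n => [|n IH]; first by rewrite big_ord0 !mul0r.
by rewrite big_ord_recr/= IH -(natr1 n); field.
Qed.

(** The increments telescope. *)
Lemma grid_sub_const (R : zmodType) n (t : 'I_n.+1 -> R) (delta : R) :
  (forall i : 'I_n, t (lift ord0 i) - t (widen_ord (leqnSn n) i) = delta) ->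
  forall i : 'I_n.+1, t i - t ord0 = delta *+ i.
Proof.
move=> tdelta [k]; elim: k => [|k IH] kn.
  by rewrite (_ : Ordinal _ = ord0) ?subrr//; exact/val_inj.
have kn' : (k < n)%N by [].
have := tdelta (Ordinal kn').
rewrite (_ : lift _ _ = Ordinal kn); last exact/val_inj.
rewrite (_ : widen_ord _ _ = Ordinal (ltnW kn)); last exact/val_inj.
by rewrite mulrS -(IH (ltnW kn)) => <-; rewrite addrA subrK.
Qed.

Theorem mainTheorem3 (R : realType) (d : measure_display)
    (T : measurableType d) (P : probability T R)
    (n : nat) (t : 'I_n.+1 -> R) (y0 mu sigma : R)
    (eps : 'I_n -> {RV P >-> R}) (Y : 'I_n -> T -> R)
    (n_ge1 : (1 <= n)%N)
    (t_incr : forall i j : 'I_n.+1, (i < j)%N -> t i < t j)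
    (sigma_gt0 : 0 < sigma)
    (eps_indep : mutually_independent eps)
    (eps_normal : forall i : 'I_n, is_normal P (eps i) 0 (sigma ^+ 2))
    (Y_def : forall (i : 'I_n) (w : T),
      Y i w = y0 + mu * (t (lift ord0 i) - t ord0) + eps i w) :
  let muhatY : T -> R := fun w => mu_hat t y0 (fun i => Y i w) in
  let v : R :=
    sigma ^+ 2 * (\sum_(i < n) (t (lift ord0 i) - t ord0) ^+ 2)^-1 in
  [/\ is_mle (fun m y => likelihood t y0 m sigma y) (mu_hat t y0),
      [/\ is_normal P muhatY mu v,
          ('E_P[muhatY] = mu%:E)%E &
          'V_P[muhatY] = v%:E] &
      forall delta : R,
        (forall i : 'I_n,
          t (lift ord0 i) - t (widen_ord (leqnSn n) i) = delta) ->
        'V_P[muhatY] =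
          (6 * sigma ^+ 2 /
           (delta ^+ 2 * n%:R * (n%:R + 1) * (2 * n%:R + 1)))%:E].
Proof.
move=> muhatY v.
pose h i := t (lift ord0 i) - t ord0.
have h_gt0 i : 0 < h i by rewrite subr_gt0 t_incr.
pose S := \sum_(i < n) h i ^+ 2.
have S_gt0 : 0 < S.
  rewrite /S (bigD1 (Ordinal n_ge1))//=.
  by rewrite ltr_wpDr ?exprn_gt0// sumr_ge0// => i _; exact: sqr_ge0.
have muhatY_normal : is_normal P muhatY mu v.
  (* The estimator is the sum of the [a i * eps i + b i]: the drift is split among the summands so
     that each is an affine image of one error. As the [h i ^+ 2] add up to [S], the [b i] add up to
     [mu] and the [a i ^+ 2] to [S^-1]. *)
  pose a i := h i / S; pose b i := a i * (h i * mu).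
  have a0 i : a i != 0 by rewrite mulf_neq0 ?invr_neq0// gt_eqF.
  have mf i : measurable_fun [set: R] (fun x => a i * x + b i).
    by apply: measurable_funD => //; exact: measurable_funM.
  pose f i : {mfun R >-> R} := mfun_Sub (mem_set (mf i)).
  have := is_normal_sum n_ge1 (mutually_independent_comp f eps_indep)
    (fun i => is_normal_affine (b i) (a0 i) (eps_normal i)).
  rewrite (_ : \sum_i (a i * 0 + b i) = mu); last first.
    transitivity (\sum_i h i ^+ 2 * (mu / S)).
      by apply: eq_bigr => i _; rewrite /b /a; field; rewrite gt_eqF.
    by rewrite -mulr_suml -/S; field; rewrite gt_eqF.
  rewrite (_ : \sum_i _ = v); last first.
    rewrite -mulr_suml /v mulrC -/S; congr (_ * _).
    under eq_bigr do rewrite exprMn.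
    by rewrite -mulr_suml -/S; field; rewrite gt_eqF.
  congr is_normal; apply/funext => w.
  rewrite /muhatY /mu_hat mulr_suml; apply: eq_bigr => i _.
  by rewrite /= Y_def /b /a -/S -/(h i); field; rewrite gt_eqF.
have V_muhatY := variance_normal muhatY_normal.
split; first exact: is_mle_mu_hat.
  by split => //; exact: expectation_normal muhatY_normal.
move=> delta tdelta; rewrite V_muhatY /v; congr EFin.
(* The index [lift ord0 i] has value [i.+1], so the squares summed are those of 1 to [n]. *)
under eq_bigr do rewrite (grid_sub_const tdelta) -mulr_natr exprMn.
rewrite -mulr_sumr sum_sqr_nat ?pnatr_eq0// !invfM invrK.
ring.
Qed.
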